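(* Let $G$ be a graph with minimum degree $\delta(G)\geq 2$ which is not a cycle, and let $G_1,\ldots,G_q$ be all the non-trivial blocks of $G$. (i) If $\mathrm{dim}(G_i)\leq 2c(G_i)-1$ for every $i$ such that $G_i$ is not a cycle, then $\mathrm{dim}(G)\leq 2c(G)-1$. (ii) If $\mathrm{edim}(G_i)\leq 2c(G_i)-1$ for every $i$ such that $G_i$ is not a cycle, then $\mathrm{edim}(G)\leq 2c(G)-1$.
   Context: All graphs are finite, simple and connected. The cyclomatic number is $c(H)=|E(H)|-|V(H)|+1$. A block of $G$ is a maximal $2$-connected subgraph (including bridges $K_2$); a block is non-trivial if it has at least three vertices. For vertices $u,v$, $d(u,v)$ is the length of a shortest $u$–$v$ path; for a vertex $u$ and an edge $e=vw$, $d(u,e)=\min\{d(u,v),d(u,w)\}$. A set $S\subseteq V(H)$ is a vertex (resp. edge) metric generator of $H$ if for every pair of distinct vertices (resp. edges) $x,x'$ of $H$ there is $s\in S$ with $d(s,x)\neq d(s,x')$. $\mathrm{dim}(H)$ (resp. $\mathrm{edim}(H)$) is the minimum size of a vertex (resp. edge) metric generator of $H$. *)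

(* Defs.v *)
From mathcomp Require Import all_boot all_order all_algebra.

Set Implicit Arguments.
Unset Strict Implicit.
Unset Printing Implicit Defensive.

Import Order.TTheory GRing.Theory Num.Theory.

(* A finite simple graph whose vertices are drawn from an ambient finite type
   T; edges are 2-element sets of vertices.  The vertex set need not be all of
   T, so that subgraphs are graphs over the same T. *)
Record graph (T : finType) := Graph {
  verts : {set T};
  edges : {set {set T}};
  edges_wf : [forall A in edges, (A \subset verts) && (#|A| == 2)]
}.

Section Graphs.
Variable T : finType.
Implicit Types (G H K : graph T) (u v w x : T) (A B S : {set T}).

Definition adj H : rel T := fun u v => [set u; v] \in edges H.

Definition connected H : Prop :=
  verts H != set0 /\ {in verts H &, forall u v, connect (adj H) u v}.

Definition degree H v : nat := #|[set w | adj H v w]|.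

(* The neutral element #|T| exceeds every degree. *)
Definition min_degree H : nat := \big[Order.min/#|T|]_(v in verts H) degree H v.

Definition cyclomatic H : int := (#|edges H|%:Z - #|verts H|%:Z + 1)%R.

Definition is_cycle H : Prop :=
  exists p : seq T,
    [/\ 2 < size p, uniq p, verts H = [set x in p]
      & edges H = [set [set x; next p x] | x in p]].

Definition subgraph H G : bool :=
  (verts H \subset verts G) && (edges H \subset edges G).

Lemma del_vertex_wf H v :
  [forall A in [set A in edges H | v \notin A],
     (A \subset verts H :\ v) && (#|A| == 2)].
Proof.
apply/forall_inP => A; rewrite inE => /andP[AH vA].
have /andP[sA ->] := forall_inP (edges_wf H) A AH.
by rewrite subsetD1 sA vA.
Qed.

Definition del_vertex H v : graph T := Graph (del_vertex_wf H v).

(* K_2 satisfies this predicate, and a K_2 is maximal for it in G exactly when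
   it is a bridge. *)
Definition two_connected H : Prop :=
  [/\ 2 <= #|verts H|, connected H
    & {in verts H, forall v, connected (del_vertex H v)}].

Definition block G H : Prop :=
  [/\ subgraph H G, two_connected H
    & forall K, subgraph K G -> two_connected K -> subgraph H K ->
        subgraph K H].

Definition nontrivial_block G H : Prop := block G H /\ 3 <= #|verts H|.

Definition has_path H u v (n : nat) : bool :=
  [exists p : n.-tuple T,
    [&& path (adj H) u p, uniq (u :: p) & last u p == v]].

(* Paths have length less than #|T|; the value is #|T| when u and v are not
   joined by any path. *)
Definition dist H u v : nat := find (has_path H u v) (iota 0 #|T|).

(* For A = [set v; w] this is minn (dist H u v) (dist H u w), since distances
   never exceed #|T|. *)
Definition edist H u A : nat := \big[Order.min/#|T|]_(v in A) dist H u v.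

Definition metric_generator H S : bool :=
  (S \subset verts H) &&
  [forall x in verts H, forall y in verts H,
     (x != y) ==> [exists s in S, dist H s x != dist H s y]].

Definition edge_metric_generator H S : bool :=
  (S \subset verts H) &&
  [forall A in edges H, forall B in edges H,
     (A != B) ==> [exists s in S, edist H s A != edist H s B]].

(* The whole vertex set is a generator of either kind (lemmas below), so both
   minima range over a nonempty family. *)
Definition metric_dim H : nat :=
  #|[arg min_(S < verts H | metric_generator H S) #|S|]|.

Definition edge_metric_dim H : nat :=
  #|[arg min_(S < verts H | edge_metric_generator H S) #|S|]|.

Lemma dist_eq0 H u v : (dist H u v == 0) = (u == v).
Proof.
have T_gt0 : 0 < #|T| by apply/card_gt0P; exists u.
rewrite /dist; case: #|T| T_gt0 => // n _ /=.
have -> : has_path H u v 0 = (u == v).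
  apply/existsP/idP => [[p]|uv]; first by rewrite (tuple0 p) /=.
  by exists [tuple].
by case: (u == v).
Qed.

Lemma dist_le H u v : dist H u v <= #|T|.
Proof. by rewrite -[X in _ <= X](size_iota 0) find_size. Qed.

Lemma edist_pair H u v w :
  edist H u [set v; w] = minn (dist H u v) (dist H u w).
Proof.
apply/eqP; rewrite eqn_leq leq_min -!leEnat !bigmin_le_cond ?inE ?eqxx ?orbT //=.
apply: le_bigmin => [|x]; first by rewrite leEnat geq_min dist_le.
by rewrite !inE leEnat => /orP[] /eqP->; rewrite ?geq_minl ?geq_minr.
Qed.

Lemma edist_eq0 H u A : A \in edges H -> (edist H u A == 0) = (u \in A).
Proof.
move=> /(forall_inP (edges_wf H))/andP[_ /cards2P[v [w [_ ->]]]].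
rewrite edist_pair !inE -!(dist_eq0 H).
by rewrite -!leqn0 geq_min.
Qed.

Lemma metric_generator_verts H : metric_generator H (verts H).
Proof.
rewrite /metric_generator subxx; apply/forall_inP => x xH.
apply/forall_inP => y yH; apply/implyP => xy; apply/exists_inP; exists x => //.
have /eqP-> : dist H x x == 0 by rewrite dist_eq0.
by rewrite eq_sym dist_eq0.
Qed.

Lemma edge_metric_generator_verts H : edge_metric_generator H (verts H).
Proof.
rewrite /edge_metric_generator subxx; apply/forall_inP => A AH.
apply/forall_inP => B BH; apply/implyP => AB.
have /andP[sA /eqP cA] := forall_inP (edges_wf H) A AH.
have /andP[_ /eqP cB] := forall_inP (edges_wf H) B BH.
have /subsetPn[v vA vB] : ~~ (A \subset B).
  by apply: contra AB => sAB; rewrite eqEcard sAB cA cB.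
apply/exists_inP; exists v; first exact: (subsetP sA).
have /eqP-> : edist H v A == 0 by rewrite edist_eq0.
by rewrite eq_sym edist_eq0.
Qed.

End Graphs.

(* Main.v *)
(** A graph that is not 2-connected splits at a cut vertex w into two sides A
    and B, which are isometric subgraphs, and c(G) = c(A) + c(B). If S1 + w
    resolves A and S2 + w resolves B, with S1 and S2 nonempty, then S1 and S2
    together resolve G except possibly for pairs x in A, y in B such that every
    shortest path from S1 to x and from S2 to y can be routed through w. The
    vertices of B with that property form a geodesic from w, so adding its far
    end to S2 removes all these pairs. The induction therefore carries, for a
    graph of minimum degree two outside a root v, a set of size at most 2c - 1
    which resolves the graph together with v: a cut costs one extra vertex,
    and 2c(A) - 1 + 2c(B) - 1 + 1 = 2c(G) - 1. For a block that is a cycle, a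
    neighbour of v is such a set. *)

Require Import Defs.
From mathcomp Require Import all_boot all_order all_algebra.
From mathcomp Require Import zify.

Set Implicit Arguments.
Unset Strict Implicit.
Unset Printing Implicit Defensive.

Import Order.TTheory GRing.Theory Num.Theory.

(** * Distances as shortest walks; distances to sets *)

Section Distance.
Variable T : finType.
Implicit Types (G H K : graph T) (u v w x y z : T) (A B C S : {set T}).

Lemma adj_sym H : symmetric (adj H).
Proof. by move=> x y; rewrite /adj setUC. Qed.

Lemma edge_sub H A : A \in edges H -> A \subset verts H.
Proof. by move/(forall_inP (edges_wf H))/andP => []. Qed.

Lemma edge_card H A : A \in edges H -> #|A| = 2.
Proof. by move/(forall_inP (edges_wf H))/andP => [_ /eqP]. Qed.

Lemma adjP H x y : adj H x y -> [/\ x \in verts H, y \in verts H & x != y].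
Proof.
move=> e; have := subsetP (edge_sub e); have := edge_card e.
rewrite cards2; case: (x != y) => // _ sub.
by split=> //; apply: sub; rewrite !inE eqxx ?orbT.
Qed.

Lemma edgeP H A x : A \in edges H -> x \in A ->
  exists2 y, adj H x y & A = [set x; y].
Proof.
move=> AH xA; have /eqP/cards2P[a [b [ab defA]]] := edge_card AH.
have ab_adj : adj H a b by rewrite /adj -defA.
move: xA; rewrite defA !inE => /orP[] /eqP->; first by exists b.
by exists a; rewrite 1?adj_sym 1?setUC.
Qed.

(** [dist] searches simple paths only. Shortening a walk gives a simple path, whose length is below
    [#|T|] and hence within the range searched. *)
Lemma dist_le_path H u p : path (adj H) u p -> dist H u (last u p) <= size p.
Proof.
move=> up; case: (shortenP up) => q uq unq subq.
have szq : size q < #|T| by have := max_card [in u :: q]; rewrite (card_uniqP unq).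
apply: leq_trans (uniq_leq_size (proj2 (andP unq)) subq).
rewrite leqNgt; apply/negP => /(before_find 0).
rewrite nth_iota // add0n => /existsP[]; exists (in_tuple q).
by rewrite /= uq eqxx andbT.
Qed.

Lemma distP H u v : connect (adj H) u v ->
  exists p, [/\ path (adj H) u p, last u p = v & size p = dist H u v].
Proof.
move=> /connectP[p0 p0P ->]; case: (shortenP p0P) => q uq unq _.
have szq : size q < #|T| by have := max_card [in u :: q]; rewrite (card_uniqP unq).
have hp : has (has_path H u (last u q)) (iota 0 #|T|).
  apply/hasP; exists (size q); first by rewrite mem_iota.
  by apply/existsP; exists (in_tuple q); rewrite /= uq eqxx andbT.
have := nth_find 0 hp; move: hp; rewrite has_find size_iota => ltf.
rewrite nth_iota // add0n => /existsP[p /and3P[pp _ /eqP pl]].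
by exists p; rewrite size_tuple.
Qed.

Lemma distxx H x : dist H x x = 0.
Proof. by apply/eqP; rewrite dist_eq0. Qed.

Lemma dist_gt0 H x y : (0 < dist H x y) = (x != y).
Proof. by rewrite lt0n dist_eq0. Qed.

(** A function that grows by at most one along each edge bounds distances from below; this replaces
    reasoning about all paths at once. *)
Lemma dist_potential H (f : T -> nat) u v :
    (forall x y, adj H x y -> f y <= (f x).+1) -> connect (adj H) u v ->
  f v <= f u + dist H u v.
Proof.
move=> lip /distP[p [pp <- <-]]; elim: p u pp => [|a p IH] u /=; first by rewrite addn0.
by case/andP => ua /IH; have := lip _ _ ua; lia.
Qed.

(** Descending along [f] builds a walk of length [f x] from [u], and [dist_potential] shows that no
    walk is shorter. *)
Lemma dist_eq_potential H (f : T -> nat) u :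
    f u = 0 -> u \in verts H ->
    (forall x y, adj H x y -> f y <= (f x).+1) ->
    {in verts H, forall x, x != u -> exists2 y, adj H y x & f x = (f y).+1} ->
  {in verts H, forall x, dist H u x = f x}.
Proof.
move=> fu uH lip desc x xH.
have [p [pp pl ps]] : exists p, [/\ path (adj H) u p, last u p = x & size p = f x].
  move eqn: (f x) => n; elim: n x xH eqn => [|n IH] x xH fx.
    have [->|/(desc x xH)[y _]] := eqVneq x u; last by rewrite fx.
    by exists [::].
  have [xu|/(desc x xH)[y yx]] := eqVneq x u; first by move: fx; rewrite xu fu.
  rewrite fx => -[fy]; have [yH _ _] := adjP yx.
  have [p [pp pl ps]] := IH y yH (esym fy).
  by exists (rcons p x); rewrite rcons_path last_rcons size_rcons pp pl ps.
apply/eqP; rewrite eqn_leq -{1}pl -ps dist_le_path //= ps.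
have ux : connect (adj H) u x by apply/connectP; exists p.
by have := dist_potential lip ux; rewrite fu.
Qed.

Lemma adj_dist H x y : adj H x y -> dist H x y = 1.
Proof.
move=> xy; have [_ _ nxy] := adjP xy.
apply/eqP; rewrite eqn_leq dist_gt0 nxy andbT.
by have := @dist_le_path H x [:: y]; rewrite /= xy; apply.
Qed.

Section Connected.
Variables (H : graph T) (Hc : connected H).

Lemma dist_triangle x y z : x \in verts H -> y \in verts H -> z \in verts H ->
  dist H x z <= dist H x y + dist H y z.
Proof.
move=> xH yH zH.
have [p [pp pl <-]] := distP (proj2 Hc _ _ xH yH).
have [q [qp ql <-]] := distP (proj2 Hc _ _ yH zH).
have := @dist_le_path H x (p ++ q); rewrite last_cat size_cat cat_path pl ql.
by apply; rewrite pp qp.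
Qed.

Lemma dist_sym x y : x \in verts H -> y \in verts H -> dist H x y = dist H y x.
Proof.
suff le a b : a \in verts H -> b \in verts H -> dist H a b <= dist H b a.
  by move=> xH yH; apply/eqP; rewrite eqn_leq !le.
move=> aH bH; have [p [pp pl <-]] := distP (proj2 Hc _ _ bH aH).
have := @dist_le_path H a (rev (belast b p)).
rewrite -{1}pl rev_path (@eq_path _ _ (adj H)) => [/(_ pp)|c d]; last exact: adj_sym.
rewrite size_rev size_belast; congr (dist H a _ <= _).
by case: p {pp} pl => //= c p; rewrite rev_cons last_rcons.
Qed.

Lemma dist_adj u x y : u \in verts H -> adj H x y -> dist H u y <= (dist H u x).+1.
Proof.
move=> uH xy; have [xH yH _] := adjP xy.
by have := dist_triangle uH xH yH; rewrite (adj_dist xy) addn1.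
Qed.

Lemma dist_pred w x : w \in verts H -> x \in verts H -> x != w ->
  exists2 y, adj H y x & dist H w x = (dist H w y).+1.
Proof.
move=> wH xH xw; have [p [pp pl ps]] := distP (proj2 Hc _ _ wH xH).
case/lastP: p pp pl ps => [|p a]; first by move=> _ /= wx; rewrite wx eqxx in xw.
rewrite rcons_path last_rcons size_rcons => /andP[pp pa] ax; subst a => ps.
exists (last w p) => //; apply/eqP.
by rewrite eqn_leq dist_adj // -ps ltnS dist_le_path.
Qed.

End Connected.

Lemma edist_le H u A x : x \in A -> edist H u A <= dist H u x.
Proof. by move=> xA; rewrite /edist -leEnat; apply: bigmin_le_cond. Qed.

Lemma edist_attained H u A : A != set0 -> exists2 x, x \in A & edist H u A = dist H u x.
Proof.
case/set0Pn => a aA; case: (arg_minnP (dist H u) aA) => x xA min.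
exists x => //; apply/eqP; rewrite eqn_leq edist_le //= -leEnat.
(* The default value [#|T|] of the minimum does no harm, since no distance exceeds it. *)
by apply: le_bigmin => [|y yA]; rewrite leEnat ?dist_le ?min.
Qed.

Lemma edist1 H u x : edist H u [set x] = dist H u x.
Proof.
by have [|y /set1P-> //] := @edist_attained H u [set x]; apply/set0Pn; exists x; rewrite inE.
Qed.

Lemma edist_triangle H u w A : connected H ->
    u \in verts H -> w \in verts H -> A \subset verts H -> A != set0 ->
  edist H u A <= dist H u w + edist H w A.
Proof.
move=> Hc uH wH sA /(edist_attained H w)[x xA ->].
by apply: leq_trans (edist_le H u xA) _; apply: dist_triangle => //; apply: (subsetP sA).
Qed.

End Distance.

(** * Splitting a graph at a cut vertex *)

Section Separation.
Variable T : finType.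
Implicit Types (G H K : graph T) (u v w x y z : T) (A B C S : {set T}).

Lemma induced_wf G A :
  [forall C in [set C in edges G | C \subset A],
     (C \subset verts G :&: A) && (#|C| == 2)].
Proof.
apply/forall_inP => C; rewrite inE => /andP[CG CA].
by rewrite subsetI (edge_sub CG) CA (edge_card CG) eqxx.
Qed.

Definition induced G A : graph T := Graph (induced_wf G A).

(** A side reduced to [[set w]] is allowed; proper splittings add [A != [set w]] and [B !=
    [set w]]. *)
Record separation G w A B : Prop := Separation {
  sep_cover : A :|: B = verts G;
  sep_cut : A :&: B = [set w];
  sep_edges : forall C, C \in edges G -> (C \subset A) || (C \subset B)
}.

Lemma sepC G w A B : separation G w A B -> separation G w B A.
Proof. by case=> U I E; split=> [||C /E]; rewrite 1?setUC 1?setIC 1?orbC. Qed.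

Section Sep.
Variables (G : graph T) (w : T) (A B : {set T}) (sep : separation G w A B).

Lemma sep_in : w \in A.
Proof. by have := set11 w; rewrite -(sep_cut sep) => /setIP[]. Qed.

Lemma sep_eq x : x \in A -> x \in B -> x = w.
Proof. by move=> xA xB; apply/set1P; rewrite -(sep_cut sep) inE xA. Qed.

Lemma sep_sub : A \subset verts G.
Proof. by rewrite -(sep_cover sep) subsetUl. Qed.

Lemma verts_sep : verts (induced G A) = A.
Proof. by apply/setIidPr; apply: sep_sub. Qed.

Lemma adj_induced x y : adj (induced G A) x y = [&& adj G x y, x \in A & y \in A].
Proof. by rewrite /adj inE subUset !sub1set. Qed.

Lemma sep_adj x y : adj G x y -> x \in A -> x != w -> y \in A.
Proof.
move=> /(sep_edges sep); rewrite !subUset !sub1set => /orP[/andP[] //|/andP[xB _] xA].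
by rewrite (sep_eq xA xB) eqxx.
Qed.

Let retract x := if x \in A then x else w.

(** Folding the far side onto [w] sends every edge to an edge or to a single vertex, so walks do not
    get longer. Hence a side is connected and isometric. *)
Lemma retract_path x p : path (adj G) x p ->
  exists q, [/\ path (adj (induced G A)) (retract x) q,
                last (retract x) q = retract (last x p) & size q <= size p].
Proof.
elim: p x => [|a p IH] x /=; first by exists [::].
case/andP=> xa /IH[q [qp ql qs]].
have [e|e] : retract x = retract a \/ adj (induced G A) (retract x) (retract a).
- rewrite adj_induced /retract; case: ifP => xA; case: ifP => aA; rewrite ?xA ?aA ?sep_in ?xa; auto.
  + by left; apply/eqP/idPn => /(sep_adj xa xA); rewrite aA.
  + left; apply/eqP/idPn; rewrite eq_sym => /(sep_adj _ aA) -/(_ x).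
    by rewrite adj_sym xa xA => /(_ isT).
- by exists q; rewrite e; split=> //; apply: leq_trans qs _.
- by exists (retract a :: q); rewrite /= e.
Qed.

Lemma sep_connect x y : connect (adj G) x y ->
  connect (adj (induced G A)) (retract x) (retract y).
Proof.
move=> /connectP[p /retract_path[q [qp ql _]] ->].
by apply/connectP; exists q.
Qed.

Hypothesis Gc : connected G.

Lemma sep_connected : connected (induced G A).
Proof.
split=> [|x y]; rewrite verts_sep; first by apply/set0Pn; exists w; apply: sep_in.
move=> xA yA; have := proj2 Gc _ _ (subsetP sep_sub _ xA) (subsetP sep_sub _ yA).
by move/sep_connect; rewrite /retract xA yA.
Qed.

Lemma sep_dist x y : x \in A -> y \in A -> dist (induced G A) x y = dist G x y.
Proof.
move=> xA yA; apply/eqP; rewrite eqn_leq; apply/andP; split.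
  have [p [pp pl <-]] := distP (proj2 Gc _ _ (subsetP sep_sub _ xA) (subsetP sep_sub _ yA)).
  have [q [qp ql qs]] := retract_path pp.
  by apply: leq_trans qs; have := dist_le_path qp; rewrite ql pl /retract xA yA.
have [p [pp <- <-]] : exists p, [/\ path (adj (induced G A)) x p, last x p = y
    & size p = dist (induced G A) x y].
  by apply: distP; apply: (proj2 sep_connected); rewrite verts_sep.
apply: dist_le_path; apply: sub_path pp => a b.
by rewrite adj_induced => /andP[].
Qed.

Lemma sep_dist_cut x y : x \in A -> y \in B -> dist G x y = dist G x w + dist G w y.
Proof.
move=> xA yB; have wG := subsetP sep_sub _ sep_in.
have BG : B \subset verts G by rewrite -(sep_cover sep) subsetUr.
have xG := subsetP sep_sub _ xA; have yG := subsetP BG _ yB.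
apply/eqP; rewrite eqn_leq dist_triangle //=.
(* The two branches agree at [w], the only common vertex, and each edge lies within one side, so [f]
   is a potential. *)
pose f z := if z \in B then dist G x w + dist G w z else dist G x z.
have fA z : z \in A -> f z = dist G x z.
  by move=> zA; rewrite /f; case: ifP => // zB; rewrite (sep_eq zA zB) distxx addn0.
have lip a b : adj G a b -> f b <= (f a).+1.
  move=> ab; have := sep_edges sep ab; rewrite !subUset !sub1set.
  case/orP=> /andP[aS bS]; first by rewrite !fA // dist_adj.
  by rewrite /f aS bS -addnS leq_add2l dist_adj.
by have := dist_potential lip (proj2 Gc _ _ xG yG); rewrite (fA x xA) distxx /f yB.
Qed.

Lemma sep_edist x C : x \in A -> C \subset A -> edist (induced G A) x C = edist G x C.
Proof. by move=> xA CA; apply: eq_bigr => y yC; rewrite sep_dist // (subsetP CA). Qed.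

Lemma sep_edist_cut x C : x \in A -> C \subset B -> C != set0 ->
  edist G x C = dist G x w + edist G w C.
Proof.
move=> xA CB C0; have cut y yC := sep_dist_cut xA (subsetP CB y yC).
have [y yC eqx] := edist_attained G x C0; have [z zC eqw] := edist_attained G w C0.
apply/eqP; rewrite eqn_leq; apply/andP; split.
  by rewrite eqw -cut // edist_le.
by rewrite eqx (cut y yC) leq_add2l edist_le.
Qed.

Lemma sep_degree x : x \in A -> x != w -> degree (induced G A) x = degree G x.
Proof.
move=> xA xw; apply: eq_card => y; rewrite !inE adj_induced xA /=.
by case xy: (adj G x y) => //=; apply: sep_adj xy xA xw.
Qed.

(** Some vertex of [K] in [A] differs from [w]. Deleting [w] keeps [K] connected, and a walk that
    avoids [w] cannot leave [A]. *)
Lemma sep_two_connected K : subgraph K G -> two_connected K ->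
  1 < #|verts K :&: A| -> verts K \subset A.
Proof.
case/andP=> KG eKG [_ [_ Kc] Kdc] /card_gt1P[a [b [aKA bKA ab]]].
have [x /setIP[xK xA] xw] : exists2 x, x \in verts K :&: A & x != w.
  by have [aw|] := eqVneq a w; [exists b; rewrite // -aw eq_sym | exists a].
apply/subsetP => y yK; have [-> |yw] := eqVneq y w; first exact: sep_in.
have : connect (adj (del_vertex K w)) x y.
  have [wK|wK] := boolP (w \in verts K).
    by apply: (proj2 (Kdc w wK)); rewrite !inE ?xw ?yw.
  (* If [w] is not in [K], deleting it changes no adjacency. *)
  rewrite (eq_connect (e' := adj K)) ?Kc // => u v.
  rewrite /adj inE; case uv: (_ \in edges K) => //=.
  by apply: contra wK; apply: (subsetP (edge_sub uv)).
case/connectP => p; elim: p x xA {xK} xw => [|c p IH] x xA xw /=; first by move=> _ ->.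
case/andP; rewrite {1}/adj inE !inE negb_or => /andP[xc /andP[_ wc]].
by apply: IH; [apply: sep_adj (subsetP eKG _ xc) xA xw | rewrite eq_sym].
Qed.

(** A 2-connected subgraph of [G] containing [K] shares at least three vertices with [A], so it lies
    inside [A], where [K] is already maximal. *)
Lemma sep_block K : nontrivial_block (induced G A) K -> nontrivial_block G K.
Proof.
case=> -[KA K2 Kmax] K3; split=> //; move: KA.
rewrite /subgraph verts_sep => /andP[vKA eKA].
split=> // [|L LG L2 KL].
  rewrite /subgraph (subset_trans vKA sep_sub); apply: subset_trans eKA _.
  by apply/subsetP => C; rewrite inE => /andP[].
apply: Kmax => //; have /andP[vKL eKL] := KL.
have LA : verts L \subset A.
  apply: sep_two_connected => //; apply: leq_trans (ltnW K3) _.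
  by apply: subset_leq_card; rewrite subsetI vKL.
rewrite /subgraph verts_sep LA; apply/subsetP => C CL; rewrite inE.
by rewrite (subsetP (proj2 (andP LG))) // (subset_trans (edge_sub CL)).
Qed.

End Sep.

(** No edge fits inside [[set w]], so the edges split without overlap, while [w] is counted on both
    sides; this extra vertex offsets the second [+ 1]. *)
Lemma sep_cyclomatic G w A B : separation G w A B ->
  cyclomatic G = (cyclomatic (induced G A) + cyclomatic (induced G B))%R.
Proof.
move=> sep; rewrite /cyclomatic (verts_sep sep) (verts_sep (sepC sep)).
have := cardsUI A B; rewrite (sep_cover sep) (sep_cut sep) cards1 => cardV.
have : #|edges G| = #|edges (induced G A)| + #|edges (induced G B)|.
  have disj : edges (induced G A) :&: edges (induced G B) = set0.
    apply/setP => C; rewrite !inE; apply/negP => /andP[/andP[/edge_card cC CA] /andP[_ CB]].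
    suff : #|C| <= 1 by rewrite cC.
    by rewrite -(cards1 w) subset_leq_card // -(sep_cut sep) subsetI CA.
  rewrite -cardsUI disj cards0 addn0; apply: eq_card => C; rewrite !inE -andb_orr.
  by case CG: (C \in edges G) => //=; rewrite (sep_edges sep CG).
by lia.
Qed.

Lemma separation_exists G : connected G -> 1 < #|verts G| ->
  two_connected G \/
  exists w A B, [/\ separation G w A B, A != [set w] & B != [set w]].
Proof.
move=> Gc G2.
(* Connectedness after each deletion is phrased as a boolean, so that its failure yields a vertex
   [w] and two vertices [x], [y] that its removal disconnects. *)
have [/forall_inP all_conn|] := boolP [forall v in verts G,
    [forall x in verts G :\ v, forall y in verts G :\ v, connect (adj (del_vertex G v)) x y]].
  left; split=> // v vG; split=> [|x y xG yG].
    by move: G2; rewrite -card_gt0 (cardsD1 v) vG.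
  by have /forall_inP/(_ x xG)/forall_inP/(_ y yG) := all_conn v vG.
case/forall_inPn=> w wG /forall_inPn[x xG /forall_inPn[y yG nxy]]; right.
pose e := adj (del_vertex G w).
(* The component of [x] once [w] is deleted; one side is [C] with [w] added, the other is the
   complement of [C]. *)
pose C := [set z in verts G | connect e x z].
have esym : connect_sym e by apply: sym_connect_sym => a b; rewrite /e adj_sym.
have wC : w \notin C.
  rewrite inE wG /= esym; apply/negP => /connectP[[|a p] /=].
    by move=> _ xw; move: xG; rewrite xw !inE eqxx.
  by case/andP; rewrite /e /adj !inE eqxx andbF.
have [[xw xG'] [yw yG']] : (x != w /\ x \in verts G) /\ (y != w /\ y \in verts G).
  by move: xG yG; rewrite !inE => /andP[-> ->] /andP[-> ->].
exists w, (w |: C), (verts G :\: C); split; last 2 first.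
- by apply/eqP => /setP/(_ x); rewrite !inE (negPf xw) xG' connect0.
- by apply/eqP => /setP/(_ y); rewrite !inE (negPf yw) yG' nxy.
split.
- apply/setP => z; rewrite !inE; case: eqP => [->|_]; rewrite ?wG ?(negPf wC) //=.
  by case: (z \in verts G); case: connect.
- apply/setP => z; rewrite in_setI in_setU1 in_setD in_set1; case: eqP => [->|_] /=.
    by rewrite wC wG.
  by case: (z \in C).
- move=> D DG; have [wD|wD] := boolP (w \in D).
    have [z wz ->] := edgeP DG wD; have [_ zG _] := adjP wz.
    rewrite !subUset !sub1set !in_setU1 !in_setD eqxx wC wG zG /=.
    by case: (z \in C); rewrite ?orbT.
  have /eqP/cards2P[a [b [ab defD]]] := edge_card DG.
  have eab : e a b by rewrite /e /adj inE -defD DG.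
  have [aG bG _] := adjP (eab : adj (del_vertex G w) a b).
  have {}aG : a \in verts G by move: aG; rewrite inE => /andP[].
  have {}bG : b \in verts G by move: bG; rewrite inE => /andP[].
  have aC : (a \in C) = (b \in C).
    rewrite !inE aG bG /=.
    by rewrite (same_connect1r esym eab).
  rewrite defD !subUset !sub1set !in_setU1 !in_setD -aC aG bG.
  by case: (a \in C); rewrite ?orbT.
Qed.

End Separation.

(** * Resolving sets and their behaviour at a cut vertex *)

Section Resolving.
Variable T : finType.
Implicit Types (G H K : graph T) (u v w x y z : T) (A B C S : {set T}) (b : bool).

(* Both dimensions at once: vertices are the singletons, so that [edist] is the
   distance to an object of either kind. *)
Definition objects b H : {set {set T}} :=
  if b then [set [set x] | x in verts H] else edges H.

Definition resolves b H S : Prop :=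
  {in objects b H &, forall A B, A != B ->
     exists2 s, s \in S & edist H s A != edist H s B}.

(* An object violating this inequality for every s is seen from S as if it lay
   beyond the cut vertex w, so S cannot tell it from objects glued on at w. *)
Definition bypasses b H w S : Prop :=
  {in objects b H, forall A, A != [set w] ->
     exists2 s, s \in S & edist H s A < dist H s w + edist H w A}.

Lemma objects_sub b H A : A \in objects b H -> A \subset verts H.
Proof. by case: b => [/imsetP[x xH ->]|/edge_sub //]; rewrite sub1set. Qed.

Lemma objects_neq0 b H A : A \in objects b H -> A != set0.
Proof.
case: b => [/imsetP[x xH ->]|/edge_card cA]; last by rewrite -card_gt0 cA.
by apply/set0Pn; exists x; rewrite inE.
Qed.

Lemma resolvesS b H S S' : S \subset S' -> resolves b H S -> resolves b H S'.
Proof.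
move=> sub res A B AH BH /(res A B AH BH)[s sS].
by exists s; rewrite // (subsetP sub).
Qed.

Section Gated.
Variables (H : graph T) (w : T) (S : {set T}).
Hypotheses (Hc : connected H) (wH : w \in verts H) (SH : S \subset verts H).

(** One inequality always holds by [edist_triangle], so failing to be gated amounts to the strict
    inequality in [bypasses]. *)
Definition gated A := [forall s in S, edist H s A == dist H s w + edist H w A].

Lemma gated1 x : x \in verts H ->
  (forall s, s \in S -> dist H s w + dist H w x <= dist H s x) -> gated [set x].
Proof.
move=> xH le; apply/forall_inP => s sS; rewrite !edist1 eqn_leq le // andbT.
by apply: dist_triangle => //; apply: (subsetP SH).
Qed.

Lemma gated_dist x s : gated [set x] -> s \in S -> dist H s x = dist H s w + dist H w x.
Proof. by move=> /forall_inP gx /gx; rewrite !edist1 => /eqP. Qed.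

Lemma gated_nearest A x : A \subset verts H -> gated A -> x \in A ->
  dist H w x = edist H w A -> gated [set x].
Proof.
move=> AH /forall_inP gA xA wx; apply: gated1 => [|s sS]; first exact: (subsetP AH).
by rewrite wx -(eqP (gA s sS)) edist_le.
Qed.

(** A step along an edge changes the distance from [s] by at most one, so the predecessor of [x] on
    a geodesic from [w] is gated too. The joining edge is recorded for the edge version. *)
Lemma gated_pred x : x \in verts H -> x != w -> gated [set x] ->
  exists y, [/\ adj H y x, dist H w x = (dist H w y).+1, gated [set y] & gated [set y; x]].
Proof.
move=> xH xw gx; have [y yx wx] := dist_pred Hc wH xH xw.
have [yH _ _] := adjP yx.
have gy : gated [set y].
  apply: gated1 => // s sS; have := dist_adj Hc (subsetP SH s sS) yx.
  by rewrite (gated_dist gx sS) wx addnS ltnS.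
exists y; split=> //; apply/forall_inP => s sS; rewrite !edist_pair.
by rewrite (gated_dist gx sS) (gated_dist gy sS) wx; clear; apply/eqP; lia.
Qed.

Lemma gated_geodesic x i : x \in verts H -> gated [set x] -> i <= dist H w x ->
  exists y, [/\ y \in verts H, gated [set y], dist H w y = i & dist H y x + i = dist H w x].
Proof.
move=> xH gx; move eqn: (dist H w x - i) => n; elim: n i eqn => [|n IH] i eqn lei.
  by exists x; split=> //; [lia | rewrite distxx; lia].
have [||y [yH gy wy yx]] := IH i.+1; [lia | lia |].
have yw : y != w by rewrite eq_sym -(dist_gt0 H) wy.
have [z [zy]] := gated_pred yH yw gy; rewrite wy => -[wz] gz _.
have [zH _ _] := adjP zy.
exists z; split=> //; have := dist_triangle Hc zH yH xH; rewrite (adj_dist zy).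
by have := dist_triangle Hc wH zH xH; clear -wz yx; lia.
Qed.

(** Every [s] in [S] sees a gated object at its distance from [w] plus a constant, so only the
    distance from [w] can separate two of them. *)
Lemma gated_eq b A B : resolves b H (w |: S) -> A \in objects b H -> B \in objects b H ->
  gated A -> gated B -> edist H w A = edist H w B -> A = B.
Proof.
move=> res AH BH /forall_inP gA /forall_inP gB eqw; apply/eqP/idPn => /(res A B AH BH)[s].
rewrite !inE => /orP[/eqP->|sS]; first by rewrite eqw eqxx.
by rewrite (eqP (gA s sS)) (eqP (gB s sS)) eqw eqxx.
Qed.

Lemma not_gated b A : A \in objects b H -> ~~ gated A ->
  exists2 s, s \in S & edist H s A < dist H s w + edist H w A.
Proof.
move=> AH /forall_inPn[s sS ne]; exists s; rewrite // ltn_neqAle ne.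
apply: edist_triangle => //; [exact: (subsetP SH) | exact: objects_sub AH | exact: objects_neq0 AH].
Qed.

(* By [gated_geodesic] and [gated_eq] the gated objects form a single geodesic
   issuing from w, and its far end z sees each of them directly. *)
Lemma bypasses_extend b : resolves b H (w |: S) ->
  exists2 z, z \in verts H & bypasses b H w (z |: S).
Proof.
move=> res.
have [[A0 A0P]|none] := pickP [pred A in objects b H | (A != [set w]) && gated A]; last first.
  (* With no gated object besides possibly [[set w]], [S] already suffices and any added vertex will
     do. *)
  exists w => // A AH Aw; have := none A; rewrite inE /= AH Aw /= => /negbT/(not_gated AH)[s sS].
  by exists s; rewrite // inE sS orbT.
have [A [AH Aw gA maxA]] : exists A : {set T}, [/\ A \in objects b H, A != [set w], gated A &
    forall B, B \in objects b H -> B != [set w] -> gated B -> edist H w B <= edist H w A].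
  have [A /and3P[AH Aw gA] maxA] := arg_maxnP (edist H w) A0P.
  by exists A; split=> // B BH Bw gB; apply: maxA; apply/and3P.
clear A0 A0P.
have [x xA wx] := edist_attained H w (objects_neq0 AH).
have xH := subsetP (objects_sub AH) x xA.
have gx := gated_nearest (objects_sub AH) gA xA (esym wx).
suff [z zH zP] : exists2 z, z \in verts H &
    forall B, B \in objects b H -> B != [set w] -> gated B ->
      edist H z B < dist H z w + edist H w B.
  exists z => // B BH Bw; have [gB|/(not_gated BH)[s sS]] := boolP (gated B).
    by exists z; [rewrite setU11 | apply: zP].
  by exists s; rewrite // inE sS orbT.
have le_max B : B \in objects b H -> B != [set w] -> gated B -> edist H w B <= dist H w x.
  by rewrite -wx; apply: maxA.
case: b res AH {maxA} le_max => [] res AH le_max.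
  (* Vertex version: the farthest gated vertex is the far end of the geodesic. *)
  exists x => // _ /imsetP[y yH ->] yw gy.
  have {}yw : 0 < dist H w y by rewrite dist_gt0 eq_sym -(inj_eq set1_inj).
  have yO : [set y] \in objects true H by apply: imset_f.
  have := le_max _ yO; rewrite !edist1 (inj_eq set1_inj) eq_sym -(dist_gt0 H) => /(_ yw gy) le.
  have [y' [y'H gy' wy' y'x]] := gated_geodesic xH gx le.
  have {}wy' : y' = y.
    by apply: set1_inj; apply: gated_eq res _ yO gy' gy _; rewrite ?edist1 // imset_f.
  by subst y'; rewrite (dist_sym Hc xH y'H) (dist_sym Hc xH wH); clear -yw y'x; lia.
have edge_eq B C : B \in edges H -> C \in edges H -> gated B -> gated C ->
    edist H w B = edist H w C -> B = C := @gated_eq false B C res.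
have [z xz defA] := edgeP AH xA; have [_ zH nxz] := adjP xz.
(* Gated vertices equally far from [w] are the far ends of gated edges equally far from [w]. These
   edges coincide by [edge_eq], hence so do the vertices. *)
have vertex_eq x1 x2 : x1 \in verts H -> x2 \in verts H -> gated [set x1] -> gated [set x2] ->
    dist H w x1 = dist H w x2 -> x1 = x2.
  move=> x1H x2H g1 g2 eqw.
  have [x1w|x1w] := eqVneq x1 w; first by apply/eqP; rewrite x1w -(dist_eq0 H) -eqw x1w distxx.
  have x2w : x2 != w by rewrite eq_sym -(dist_gt0 H) -eqw dist_gt0 eq_sym.
  have [y1 [a1 d1 _ ge1]] := gated_pred x1H x1w g1.
  have [y2 [a2 d2 _ ge2]] := gated_pred x2H x2w g2.
  have /setP/(_ x1) : [set y1; x1] = [set y2; x2].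
    apply: (edge_eq _ _ a1 a2 ge1 ge2); move: eqw; rewrite !edist_pair d1 d2.
    by rewrite !(minn_idPl (leqnSn _)) => -[].
  by rewrite !inE eqxx orbT => /esym/orP[] /eqP // e; move: d2; rewrite -eqw e => /n_Sn.
(* If both ends of [A] were equally far from [w], both would be gated, against [vertex_eq]. So [z]
   is the outer end of the farthest gated edge. *)
have wz : dist H w z = (dist H w x).+1.
  apply/eqP; rewrite eqn_leq dist_adj //= ltn_neqAle.
  rewrite -{2}wx edist_le ?defA ?inE ?eqxx ?orbT // andbT.
  apply: contra nxz => /eqP e; apply/eqP; apply: vertex_eq => //.
  by apply: gated_nearest gA _ _; rewrite ?(edge_sub AH) ?defA ?inE ?eqxx ?orbT // -defA -e.
exists z => // B BH _ gB.
have Bw : B != [set w] by apply/eqP => e; move: (edge_card BH); rewrite e cards1.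
have := le_max B BH Bw gB; rewrite leq_eqVlt => /orP[/eqP e|lt].
  have -> : B = A by apply: (edge_eq _ _ BH AH gB gA); rewrite e wx.
  have : edist H z A == 0 by rewrite edist_eq0 // defA !inE eqxx orbT.
  by move/eqP->; rewrite (dist_sym Hc zH wH) wz.
(* [y] is taken one step beyond the distance of [B], so that the edge from its predecessor to [y] is
   as far from [w] as [B] and must equal [B]. *)
have [y [yH gy wy yx]] := gated_geodesic xH gx lt.
have yw : y != w by rewrite eq_sym -(dist_gt0 H) wy.
have [y' [ay dy _ gey]] := gated_pred yH yw gy.
have -> : B = [set y'; y].
  by apply: (edge_eq _ _ BH ay gB gey); rewrite edist_pair; clear -wy dy; lia.
rewrite !edist_pair (dist_sym Hc zH wH) (dist_sym Hc zH yH).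
have := dist_adj Hc yH xz; have [y'H _ _] := adjP ay.
by clear -wy dy yx wz; lia.
Qed.

End Gated.

Lemma sep_objects b G w A B C : separation G w A B -> C \in objects b G ->
  C \in objects b (induced G A) \/ C \in objects b (induced G B).
Proof.
move=> sep; case: b => [/imsetP[x xG ->]|CG].
  move: xG; rewrite -(sep_cover sep) inE => /orP[] xS; [left|right]; apply: imset_f.
    by rewrite (verts_sep sep).
  by rewrite (verts_sep (sepC sep)).
by case/orP: (sep_edges sep CG) => CS; [left|right]; rewrite inE CG.
Qed.

(** The delicate pairs have [C] in [A] and [D] in [B]. If [s1] in [S1] does not separate them, then
    [D] is no farther from [w] than [C]; if the [s] given by [bypasses] does not either, then [C] is
    strictly closer to [w] than [D], a contradiction. *)
Lemma sep_resolves b G w A B S1 S2 : connected G -> separation G w A B ->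
    S1 \subset A -> S2 \subset B -> S1 != set0 -> S2 != set0 ->
    resolves b (induced G A) (w |: S1) -> resolves b (induced G B) (w |: S2) ->
    bypasses b (induced G B) w S2 ->
  resolves b G (S1 :|: S2).
Proof.
move=> Gc sep S1A S2B /set0Pn[s1 s1S] /set0Pn[s2 s2S] res1 res2 byp.
have sep' := sepC sep.
have oA C : C \in objects b (induced G A) -> C \subset A.
  by move/objects_sub; rewrite (verts_sep sep).
have oB C : C \in objects b (induced G B) -> C \subset B.
  by move/objects_sub; rewrite (verts_sep sep').
have wA := sep_in sep; have wB := sep_in sep'.
(* Seen from one side, a vertex of the other side resolves exactly what w does. *)
have side A' B' S S' s C D : separation G w A' B' -> S \subset A' -> S' \subset B' -> s \in S' ->
    C \in objects b (induced G A') -> D \in objects b (induced G A') -> C != D ->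
    resolves b (induced G A') (w |: S) ->
    exists2 t, t \in S :|: S' & edist G t C != edist G t D.
  move=> sp SA SB sS CO DO CD /(_ C D CO DO CD)[t].
  have CA : C \subset A' by have := objects_sub CO; rewrite (verts_sep sp).
  have DA : D \subset A' by have := objects_sub DO; rewrite (verts_sep sp).
  rewrite in_setU1 => /orP[/eqP->|tS]; last first.
    rewrite !(sep_edist sp Gc (subsetP SA t tS)) // => ne.
    by exists t; rewrite // inE tS.
  rewrite !(sep_edist sp Gc (sep_in sp)) // => ne.
  exists s; first by rewrite inE sS orbT.
  have cut := sep_edist_cut (sepC sp) Gc (subsetP SB s sS).
  by rewrite (cut C CA (objects_neq0 CO)) (cut D DA (objects_neq0 DO)) eqn_add2l.
have mixed C D : C \in objects b (induced G A) -> D \in objects b (induced G B) -> C != D ->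
    exists2 t, t \in S1 :|: S2 & edist G t C != edist G t D.
  move=> CO DO CD; have [Dw|Dw] := eqVneq D [set w].
    (* The object [[set w]] belongs to both sides, so this pair lies within [A]; it occurs only in
       the vertex version, as an edge has two vertices. *)
    apply: (side _ _ _ _ _ _ _ sep S1A S2B s2S CO _ CD res1).
    clear -sep DO Dw wA; move: DO; rewrite Dw.
    case: b => [_|/edge_card]; last by rewrite cards1.
    by apply: imset_f; rewrite (verts_sep sep).
  have [s sS] := byp D DO Dw.
  have DB := oB D DO; have CA := oA C CO.
  have C0 := objects_neq0 CO; have D0 := objects_neq0 DO.
  have sInB := subsetP S2B s sS.
  rewrite (sep_edist sep' Gc sInB DB) (sep_dist sep' Gc sInB wB) (sep_edist sep' Gc wB DB) => lt.
  have [e1|] := eqVneq (edist G s1 C) (edist G s1 D); last by exists s1; rewrite // inE s1S.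
  have [e2|] := eqVneq (edist G s C) (edist G s D); last by exists s; rewrite // inE sS orbT.
  have := sep_edist_cut sep Gc (subsetP S1A _ s1S) DB D0.
  have := sep_edist_cut sep' Gc (subsetP S2B _ sS) CA C0.
  have AG := sep_sub sep.
  have := edist_triangle Gc (subsetP AG _ (subsetP S1A _ s1S)) (subsetP AG _ wA)
    (subset_trans CA AG) C0.
  by clear -lt e1 e2; lia.
move=> C D /(sep_objects sep)[CO|CO] /(sep_objects sep)[DO|DO] CD.
- exact: side sep S1A S2B s2S CO DO CD res1.
- exact: mixed.
- by rewrite eq_sym in CD; have [t tS] := mixed D C DO CO CD; exists t; rewrite // eq_sym.
- by rewrite setUC; apply: side sep' S2B S1A s1S CO DO CD res2.
Qed.

End Resolving.

(** * Distances and resolving pairs in cycles *)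

Section Cycle.
Variable T : finType.
Implicit Types (H : graph T) (v x y : T) (p q : seq T) (b : bool).

Lemma index_next v q x : uniq (v :: q) -> x \in v :: q ->
  index (next (v :: q) x) (v :: q) =
    if index x (v :: q) < size q then (index x (v :: q)).+1 else 0.
Proof.
move=> unq xp; rewrite next_nth xp; case: ltnP => [lt|ge].
  by rewrite -[nth v q _]/(nth v (v :: q) (index x (v :: q)).+1) index_uniq.
by rewrite nth_default //= eqxx.
Qed.

(** [is_cycle] with its sequence exposed, so that it can be rotated to start at a chosen vertex. *)
Definition cycle_on H p : Prop :=
  [/\ 2 < size p, uniq p, verts H = [set x in p]
    & edges H = [set [set x; next p x] | x in p]].

Lemma cycle_on_rot H p n : cycle_on H p -> cycle_on H (rot n p).
Proof.
case=> sz unq vH eH; split; rewrite ?size_rot ?rot_uniq //.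
  by rewrite vH; apply/setP => x; rewrite !inE mem_rot.
rewrite eH; apply/setP => A; apply/imsetP/imsetP => -[x xp ->]; exists x => //;
  by rewrite ?(next_rot n unq) // mem_rot in xp *.
Qed.

Lemma cycle_adj H p x y : cycle_on H p -> adj H x y ->
  y = next p x \/ x = next p y.
Proof.
case=> sz unq vH eH xy; have [_ _ nxy] := adjP xy.
move: xy; rewrite /adj eH => /imsetP[z zp e].
have : x \in [set z; next p z] by rewrite -e !inE eqxx.
have : y \in [set z; next p z] by rewrite -e !inE eqxx orbT.
by rewrite !inE => /orP[] /eqP ey /orP[] /eqP ex; subst x y; auto; rewrite eqxx in nxy.
Qed.

Lemma cycle_next H p x : cycle_on H p -> x \in p -> adj H x (next p x).
Proof. by case=> _ _ _ eH xp; rewrite /adj eH; apply: imset_f. Qed.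

(** The right-hand side is a potential: it decreases towards the predecessor on the first half of
    the cycle and towards the successor on the second. *)
Lemma cycle_dist H v q : cycle_on H (v :: q) ->
  {in v :: q, forall x, dist H v x =
     minn (index x (v :: q)) ((size q).+1 - index x (v :: q))}.
Proof.
move=> Hp; have [sz unq vH eH] := Hp.
have vE x : (x \in verts H) = (x \in v :: q) by rewrite vH inE.
pose i x := index x (v :: q).
have idx x : x \in v :: q -> i (next (v :: q) x) = if i x < size q then (i x).+1 else 0.
  exact: index_next.
have ltn x : x \in v :: q -> i x <= size q by rewrite -index_mem.
move=> x; rewrite -vE.
apply: (@dist_eq_potential _ H (fun z => minn (i z) ((size q).+1 - i z)) v).
- by rewrite /i /= eqxx min0n.
- by rewrite vE mem_head.
- move=> {x} x y xy; have [xH yH _] := adjP xy; rewrite !vE in xH yH.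
  case: (cycle_adj Hp xy) => e; [have := idx x xH | have := idx y yH];
    by rewrite -e; have := ltn x xH; have := ltn y yH; clear; case: ifP; lia.
move=> {x} x; rewrite vE => xp xv.
have ix : 0 < i x by rewrite lt0n /i /= [v == x]eq_sym (negPf xv).
have lex := ltn x xp.
have [le|gt] := leqP (i x) ((size q).+1 - i x).
  pose y := nth v (v :: q) (i x).-1.
  have lty : (i x).-1 < size (v :: q) by clear -ix lex; rewrite /=; lia.
  have yp : y \in v :: q by rewrite mem_nth.
  have iy : i y = (i x).-1 by rewrite /i index_uniq.
  have nexty : next (v :: q) y = x.
    apply: (index_inj v (s := v :: q)); rewrite ?mem_next // -/(i x) -/(i (next _ _)) idx // iy.
    by clear -ix lex; case: ifP; lia.
  exists y; first by rewrite -nexty; apply: cycle_next.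
  by rewrite iy; clear -ix lex le; lia.
exists (next (v :: q) x); first by rewrite adj_sym; apply: cycle_next.
rewrite idx //.
by clear -ix lex gt; case: ifP; lia.
Qed.

Lemma cycle_on_exists H v : is_cycle H -> v \in verts H ->
  exists s r, cycle_on H [:: v, s & r].
Proof.
case=> p Hp vH; have [sz _ vE _] := Hp.
have vp : v \in p by move: vH; rewrite vE inE.
have [i q e] := rot_to vp; have := cycle_on_rot i Hp; rewrite e.
by case: q {e} => [[]|s r] //; exists s, r.
Qed.

(** Distances from [v] determine an object up to the reflection of the cycle fixing [v]; the
    neighbour [s] breaks that symmetry. *)
Lemma cycle_resolves b H v : is_cycle H -> v \in verts H ->
  exists2 s, s \in verts H & resolves b H [set v; s].
Proof.
move=> Hcyc vH; have [s [r Hp]] := cycle_on_exists Hcyc vH.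
have [sz unq vE eE] := Hp; exists s; first by rewrite vE !inE eqxx orbT.
set p := [:: v, s & r] in Hp sz unq vE eE *.
have Hp' : cycle_on H (s :: rcons r v).
  by have := cycle_on_rot 1 Hp; rewrite rot1_cons.
pose i x := index x p; pose n := (size r).+2.
have dv x : x \in p -> dist H v x = minn (i x) (n - i x) by apply: cycle_dist.
(* Indices are counted from [v]. Seen from [s] they drop by one, except that [v] itself, of index 0,
   is a neighbour of [s]. *)
have ds x : x \in p -> dist H s x = if i x == 0 then 1 else minn (i x).-1 (n - (i x).-1).
  move=> xp; rewrite (cycle_dist Hp') ?size_rcons; last first.
    by move: xp; rewrite /p -rcons_cons mem_rcons.
  rewrite -[index x (s :: _)]/(index x (rcons (s :: r) v)) /i -cats1 index_cat -/p.
  have [->|xv] := eqVneq x v.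
    have -> : v \in s :: r = false by apply/negP => vr; move: unq; rewrite /= vr.
    by rewrite /p /= !eqxx addn0 /n; clear; lia.
  move: xp; rewrite /p in_cons (negPf xv) /= => xsr.
  by rewrite xsr [v == x]eq_sym (negPf xv).
have ltn x : x \in p -> i x < n by rewrite -index_mem.
have i_inj : {in p &, injective i} := @index_inj _ v p.
have n2 : 2 < n by [].
have next_i x : x \in p -> i (next p x) = if (i x).+1 < n then (i x).+1 else 0.
  exact: index_next.
have memp x : (x \in verts H) = (x \in p) by rewrite vE inE.
suff inj : {in objects b H &, forall A B,
    edist H v A = edist H v B -> edist H s A = edist H s B -> A = B}.
  move=> A B AO BO; have [e|ne _] := eqVneq (edist H v A) (edist H v B).
    move=> AB; exists s; first by rewrite !inE eqxx orbT.
    by apply: contra AB => /eqP e'; apply/eqP; apply: inj.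
  by exists v; rewrite // !inE eqxx.
have ltip x : x \in p -> i (next p x) < n by move=> xp; rewrite ltn ?mem_next.
case: b => A B.
  move=> /imsetP[x xH ->] /imsetP[y yH ->]; rewrite memp in xH; rewrite memp in yH.
  rewrite !edist1 !dv ?ds // => e1 e2; congr [set _]; apply: i_inj => //.
  by move: e1 e2 (ltn x xH) (ltn y yH) n2; clear; repeat case: ifP; lia.
rewrite /objects eE => /imsetP[x xp ->] /imsetP[y yp ->].
(* Edges are indexed by their first endpoint, so the reflection now sends index [i] to
   [n.-1 - i]. *)
have ev z : z \in p -> edist H v [set z; next p z] = minn (i z) (n.-1 - i z).
  move=> zp; rewrite edist_pair !dv ?mem_next // next_i //.
  by have := ltn z zp; clear; case: ifP; lia.
have es z : z \in p ->
    edist H s [set z; next p z] = if i z == 0 then 0 else minn (i z).-1 (n - i z).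
  move=> zp; rewrite edist_pair !ds ?mem_next // next_i //.
  have := ltn z zp; move: (i z) => k; clear -n2; case: k => [|k] /=; first lia.
  by case: (ltnP k.+2 n) => /=; lia.
rewrite !ev // !es // => e1 e2; suff -> : x = y by [].
apply: i_inj => //; move: e1 e2 (ltn x xp) (ltn y yp) n2; clear.
by do 2!case: ifP; lia.
Qed.

(** There are as many edges as vertices: two vertices giving the same edge would be successors of
    each other, which a sequence longer than two excludes. *)
Lemma cyclomatic_cycle H : is_cycle H -> cyclomatic H = 1%R.
Proof.
case=> p [sz unq vE eE]; rewrite /cyclomatic.
suff -> : #|edges H| = #|verts H| by lia.
rewrite vE eE card_in_imset ?cardsE // => x y xp yp e.
have : x \in [set y; next p y] by rewrite -e !inE eqxx.
have : y \in [set x; next p x] by rewrite e !inE eqxx.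
rewrite !inE => /orP[/eqP //|/eqP ey] /orP[/eqP //|/eqP ex].
have [i q defq] := rot_to xp.
have unq' : uniq (x :: q) by rewrite -defq rot_uniq.
have nx z : next p z = next (x :: q) z by rewrite -defq next_rot.
have szq : 1 < size q by move: sz; rewrite -(size_rot i p) defq.
move: ey ex; rewrite !nx; case: q szq unq' {defq nx} => [|a [|c q]] //= _ unq'.
rewrite !eqxx => ->; move: unq'; rewrite !inE !negb_or => /andP[/and3P[xa xc _] _].
by rewrite [a == x]eq_sym (negPf xa) eqxx => e'; rewrite e' eqxx in xc.
Qed.

End Cycle.

(** * Induction over cuts down to the blocks *)

Section Blocks.
Variable T : finType.
Implicit Types (G H K : graph T) (u v w x y z : T) (A B C S : {set T}) (b : bool).

Definition dimension b H : nat := if b then metric_dim H else edge_metric_dim H.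

Definition generator b H S : bool :=
  if b then metric_generator H S else edge_metric_generator H S.

Lemma generatorP b H S : reflect (S \subset verts H /\ resolves b H S) (generator b H S).
Proof.
apply: (iffP idP); case: b => /=.
- case/andP=> SH gen; split=> // _ _ /imsetP[x xH ->] /imsetP[y yH ->].
  rewrite (inj_eq set1_inj) => xy.
  have /forall_inP/(_ x xH)/forall_inP/(_ y yH)/implyP/(_ xy)/exists_inP[s sS] := gen.
  by exists s; rewrite ?edist1.
- case/andP=> SH gen; split=> // A B AH BH AB.
  have /forall_inP/(_ A AH)/forall_inP/(_ B BH)/implyP/(_ AB)/exists_inP[s sS] := gen.
  by exists s.
- case=> SH res; rewrite /metric_generator SH.
  apply/forall_inP => x xH; apply/forall_inP => y yH; apply/implyP => xy.
  apply/exists_inP; have [||| s sS] := res [set x] [set y]; rewrite ?(imset_f set1) //.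
    by rewrite (inj_eq set1_inj).
  by rewrite !edist1; exists s.
- case=> SH res; rewrite /edge_metric_generator SH.
  apply/forall_inP => A AH; apply/forall_inP => B BH; apply/implyP => AB.
  by apply/exists_inP; apply: res.
Qed.

Lemma generator_verts b H : generator b H (verts H).
Proof. by case: b; [apply: metric_generator_verts | apply: edge_metric_generator_verts]. Qed.

Lemma dimensionP b H : exists S, [/\ generator b H S, dimension b H = #|S|
  & forall S', generator b H S' -> #|S| <= #|S'|].
Proof.
rewrite /dimension /metric_dim /edge_metric_dim; have := generator_verts b H.
by case: b => gV; case: arg_minnP => // S gS min; exists S.
Qed.

Lemma dimension_attained b H :
  exists S, [/\ S \subset verts H, resolves b H S & #|S| = dimension b H].
Proof. by have [S [/generatorP[SH res] -> _]] := dimensionP b H; exists S. Qed.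

Lemma dimension_le b H S : S \subset verts H -> resolves b H S -> dimension b H <= #|S|.
Proof. by move=> SH res; have [S' [_ -> ->]] := dimensionP b H => //; apply/generatorP. Qed.

Definition blocks_bounded b G : Prop :=
  forall H, nontrivial_block G H -> ~ is_cycle H ->
    ((dimension b H)%:Z <= 2 * cyclomatic H - 1)%R.

Lemma degree_lt_card G x : x \in verts G -> degree G x < #|verts G|.
Proof.
move=> xG; rewrite (cardsD1 x) xG ltnS; apply: subset_leq_card.
by apply/subsetP => y; rewrite !inE => /adjP[_ -> xy]; rewrite eq_sym xy.
Qed.

(** The root is not counted in [S], because the other side of a cut stands in for it. Nonemptiness
    of [S] is what [sep_resolves] requires. *)
Definition rooted_bound b G v : Prop :=
  exists S, [/\ S \subset verts G, S != set0,
                (#|S|%:Z <= 2 * cyclomatic G - 1)%R & resolves b G (v |: S)].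

Lemma two_connected_block G : two_connected G -> 2 < #|verts G| -> nontrivial_block G G.
Proof. by move=> G2 G3; split=> //; split=> //; rewrite /subgraph !subxx. Qed.

Lemma two_connected_rooted_bound b G v : two_connected G -> 2 < #|verts G| ->
  v \in verts G -> blocks_bounded b G -> rooted_bound b G v.
Proof.
move=> G2 G3 vG /(_ G (two_connected_block G2 G3)) bound.
(* [is_cycle] is not a boolean, but the desired bound ranges over finitely many sets and becomes the
   boolean [P]. If no set satisfies [P], then [G] is not a cycle and the block hypothesis supplies
   one. *)
have decide : (is_cycle G -> rooted_bound b G v) -> rooted_bound b G v; last apply: decide.
  move=> cyc.
  pose P S := [&& S \subset verts G, S != set0, (#|S|%:Z <= 2 * cyclomatic G - 1)%R &
                  [forall A in objects b G, forall B in objects b G, (A != B) ==>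
                     [exists s in v |: S, edist G s A != edist G s B]]].
  have PP S : reflect [/\ S \subset verts G, S != set0, (#|S|%:Z <= 2 * cyclomatic G - 1)%R
                 & resolves b G (v |: S)] (P S).
    apply: (iffP and4P) => -[-> -> ->] res; split=> //.
      move=> A B AO BO AB.
      have /forall_inP/(_ A AO)/forall_inP/(_ B BO)/implyP/(_ AB)/exists_inP[s sS] := res.
      by exists s.
    apply/forall_inP => A AO; apply/forall_inP => B BO; apply/implyP => AB.
    by apply/exists_inP; apply: res.
  suff /existsP[S /PP SP] : [exists S, P S] by exists S.
  apply: contraT => noS; have ncyc : ~ is_cycle G.
    by move/cyc => [S /PP SP]; case/existsP: noS; exists S.
  have [S [SG res cS]] := dimension_attained b G; have := bound ncyc; rewrite -cS => le.
  have res' := resolvesS (subsetUr [set v] S) res.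
  (* An empty [S] is replaced by [[set v]]: from [0 <= 2c - 1] integrality gives [1 <= 2c - 1]. *)
  case/negP: noS; apply/existsP; have [S0|S0] := eqVneq S set0; last by exists S; apply/PP.
  exists [set v]; apply/PP; split; rewrite ?sub1set //.
  - by apply/set0Pn; exists v; rewrite inE.
  - by move: le; rewrite S0 cards0 cards1; clear; lia.
  - by apply: resolvesS res; rewrite S0 sub0set.
move=> cyc; have [s sG res] := cycle_resolves b cyc vG.
exists [set s]; split; rewrite ?sub1set ?cards1 ?cyclomatic_cycle //.
by apply/set0Pn; exists s; rewrite inE.
Qed.

Lemma rooted_bound_bypass b G v : connected G -> v \in verts G -> rooted_bound b G v ->
  exists S, [/\ S \subset verts G, S != set0, (#|S|%:Z <= 2 * cyclomatic G)%R,
                resolves b G (v |: S) & bypasses b G v S].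
Proof.
move=> Gc vG [S [SG S0 cS res]]; have [z zG byp] := bypasses_extend Gc vG SG res.
exists (z |: S); split=> //.
- by rewrite subUset sub1set zG.
- by apply/set0Pn; exists z; rewrite setU11.
- by move: cS; rewrite cardsU1; clear; case: (z \notin S); lia.
- by apply: resolvesS res; rewrite setUS // subsetUr.
Qed.

(* If the root v is not itself the cut vertex w, minimality of the side A
   containing v forces w to keep two neighbours in A, so that A is again a
   graph of degree at least two outside its root; the exception is a pendant
   edge. *)
Lemma separation_minimal G v n w A B : connected G ->
    separation G w A B -> A != [set w] -> B != [set w] -> v \in A -> #|A| <= n ->
  exists w' A' B', [/\ separation G w' A' B', A' != [set w'], B' != [set w'], v \in A'
    & [\/ w' = v, 2 <= degree (induced G A') w' | v != w' /\ A' = [set v; w']]].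
Proof.
move=> Gc; elim: n w A B => [|n IH] w A B sep Aw Bw vA leA.
  by move: leA; rewrite leqn0 cards_eq0 => /eqP A0; rewrite A0 inE in vA.
have [wv|wv] := eqVneq w v; first by exists w, A, B; split=> //; apply: Or31.
have [deg|deg] := leqP 2 (degree (induced G A) w); first by exists w, A, B; split=> //; apply: Or32.
have wA := sep_in sep; have Ac := sep_connected sep Gc.
have vE := verts_sep sep.
have [||u uw _] := dist_pred Ac _ _ wv; rewrite ?vE //.
have [uA _ nuw] := adjP uw; rewrite vE in uA; rewrite adj_sym in uw.
have only y : adj (induced G A) w y -> y = u.
  by move=> wy; apply: (card_le1_eqP deg); rewrite inE.
(* The cut moves from [w] to its only neighbour [u] in [A]; [w] and the edge [uw] pass to the other
   side. *)
have sep' : separation G u (A :\ w) (u |: B).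
  split.
  - apply/setP => z; rewrite -(sep_cover sep) !inE.
    have [->|] := eqVneq z w; first by rewrite (sep_in (sepC sep)) !orbT.
    by have [->|] := eqVneq z u; rewrite ?uA.
  - apply/setP => z; rewrite !inE; have [->|zu] /= := eqVneq z u; first by rewrite nuw uA.
    by apply/negP => /andP[/andP[zw zA] zB]; rewrite (sep_eq sep zA zB) eqxx in zw.
  - move=> C CG; case/orP: (sep_edges sep CG) => CS; last first.
      by apply/orP; right; apply: subset_trans CS (subsetUr _ _).
    have [wC|wC] := boolP (w \in C); last by rewrite subsetD1 CS wC.
    have CA : C \in edges (induced G A) by rewrite inE CG.
    have [y wy ->] := edgeP CA wC.
    by rewrite (only y wy) !subUset !sub1set !in_setU1 (sep_in (sepC sep)) eqxx !orbT.
have [Au|Au] := eqVneq (A :\ w) [set u].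
  exists w, A, B; split=> //; apply: Or33; split; first by rewrite eq_sym.
  have /set1P-> : v \in [set u] by rewrite -Au !inE eq_sym wv.
  by rewrite setUC -Au setD1K.
apply: IH sep' Au _ _ _.
- by apply/eqP => /setP/(_ w); rewrite !inE (sep_in (sepC sep)) orbT eq_sym (negPf nuw).
- by rewrite !inE eq_sym wv.
- by move: leA; rewrite (cardsD1 w) wA.
Qed.

Lemma sep_card G w A B : separation G w A B -> B != [set w] -> #|A| < #|verts G|.
Proof.
move=> sep Bw; apply: proper_card; rewrite properE (sep_sub sep) /=.
apply: contra Bw => VA; rewrite eqEsubset sub1set (sep_in (sepC sep)) andbT.
apply/subsetP => x xB; rewrite inE; apply/eqP; apply: (sep_eq sep) => //.
by apply: (subsetP VA); rewrite -(sep_cover sep) inE xB orbT.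
Qed.

Lemma sep_card_gt1 G w A B : separation G w A B -> A != [set w] -> 1 < #|A|.
Proof.
move=> sep Aw; rewrite ltnNge; apply: contra Aw => le.
by rewrite eq_sym eqEcard sub1set (sep_in sep) cards1.
Qed.

Lemma sep_blocks_bounded b G w A B : connected G -> separation G w A B ->
  blocks_bounded b G -> blocks_bounded b (induced G A).
Proof. by move=> Gc sep bound H /(sep_block sep); apply: bound. Qed.

(** Every object of this side other than [[set w]] contains [v], hence is at distance 0 from it. *)
Lemma pendant_bypasses b G v w A B : connected G -> separation G w A B -> v != w ->
  A = [set v; w] -> bypasses b (induced G A) w [set v].
Proof.
move=> Gc sep vw defA C CO Cw.
have := objects_sub CO; rewrite (verts_sep sep) => CA.
exists v; rewrite ?inE //.
have vC : v \in C.
  apply: contraR Cw => vC; have C0 := objects_neq0 CO.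
  have Cw : C \subset [set w].
    apply/subsetP => x xC; move: (subsetP CA x xC); rewrite defA !inE => /orP[/eqP xv|//].
    by rewrite -xv xC in vC.
  by have := C0; rewrite -proper0; move: Cw; rewrite subset1 => /orP[//|/eqP->]; rewrite properxx.
by apply: leq_ltn_trans (edist_le _ _ vC) _; rewrite distxx ltn_addr // dist_gt0.
Qed.

Lemma pendant_cyclomatic G v w A B : connected G -> separation G w A B -> v != w ->
  A = [set v; w] -> (0 <= cyclomatic (induced G A))%R.
Proof.
move=> Gc sep vw defA; have Ac := sep_connected sep Gc.
have inA x : x \in [set v; w] -> x \in verts (induced G A) by rewrite (verts_sep sep) defA.
have [y yv _] := dist_pred Ac (inA w (set22 _ _)) (inA v (set21 _ _)) vw.
have : 0 < #|edges (induced G A)| by apply/card_gt0P; exists [set y; v].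
have : #|A| = 2 by rewrite defA cards2 vw.
by rewrite /cyclomatic (verts_sep sep) => ->; clear; lia.
Qed.

(** The root is exempt from the degree condition because a cut vertex may lose neighbours when the
    graph is split there. *)
Lemma rooted_bound_exists b G v : connected G -> v \in verts G -> 1 < #|verts G| ->
    {in verts G, forall x, x != v -> 2 <= degree G x} -> blocks_bounded b G ->
  rooted_bound b G v.
Proof.
have [n] := ubnP #|verts G|; elim: n G v => // n IH G v; rewrite ltnS => leG Gc vG G2 deg bound.
have G3 : 2 < #|verts G|.
  have /card_gt1P[x [y [xG yG xy]]] := G2.
  have [z zG zv] : exists2 z, z \in verts G & z != v.
    by have [xv|] := eqVneq x v; [exists y; rewrite // -xv eq_sym | exists x].
  exact: leq_ltn_trans (deg z zG zv) (degree_lt_card zG).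
have [tc|[w0 [A0 [B0 [sep0 Aw0 Bw0]]]]] := separation_exists Gc G2.
  exact: two_connected_rooted_bound.
have [w [A [B [sep Aw Bw vA root]]]] : exists w A B, [/\ separation G w A B,
    A != [set w], B != [set w], v \in A
    & [\/ w = v, 2 <= degree (induced G A) w | v != w /\ A = [set v; w]]].
  move: (vG); rewrite -(sep_cover sep0) inE => /orP[vA|vB].
    exact: separation_minimal Gc sep0 Aw0 Bw0 vA (leqnn _).
  exact: separation_minimal Gc (sepC sep0) Bw0 Aw0 vB (leqnn _).
have sep' := sepC sep; have wA := sep_in sep; have wB := sep_in sep'.
have Ac := sep_connected sep Gc; have Bc := sep_connected sep' Gc.
have vEA := verts_sep sep; have vEB := verts_sep sep'.
have cG := sep_cyclomatic sep.
(* The side [B] is rooted at [w]; its other vertices differ from [v] and keep all their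
   neighbours. *)
have [S2 [S2B S20 cS2 res2]] : rooted_bound b (induced G B) w.
  apply: IH => //; rewrite ?vEB //.
  - exact: leq_trans (sep_card sep' Aw) leG.
  - exact: sep_card_gt1 sep' Bw.
  - move=> x xB xw; rewrite (sep_degree sep') // deg //.
      by apply: (subsetP (sep_sub sep')).
    by apply: contra xw => /eqP xv; rewrite xv in xB *; apply/eqP; apply: (sep_eq sep).
  - exact: sep_blocks_bounded sep' bound.
have [pend|[vw defA]] : (w = v \/ 2 <= degree (induced G A) w) \/ (v != w /\ A = [set v; w]).
  by case: root; auto.
- have [S1 [S1A S10 cS1 res1]] : rooted_bound b (induced G A) v.
    apply: IH => //; rewrite ?vEA //.
    + exact: leq_trans (sep_card sep Bw) leG.
    + exact: sep_card_gt1 sep Aw.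
    + move=> x xA xv; have [xw|xw] := eqVneq x w.
        by case: pend => [wv|]; [rewrite xw wv eqxx in xv | rewrite xw].
      by rewrite (sep_degree sep) // deg // (subsetP (sep_sub sep)).
    + exact: sep_blocks_bounded sep bound.
  (* The one extra vertex of the cut is spent on [B], giving at most [2c(A) - 1 + 2c(B)]
     vertices. *)
  have [] := rooted_bound_bypass Bc _ (ex_intro _ S2 (And4 S2B S20 cS2 res2)); first by rewrite vEB.
  move=> S [SB S0 cS res byp]; rewrite vEA in S1A; rewrite vEB in SB.
  exists (S1 :|: S); split.
  + rewrite -(sep_cover sep); exact: setUSS.
  + by rewrite -subset0 subUset negb_and !subset0 S10.
  + by move: (leq_of_leqif (leq_card_setU S1 S)) cS1 cS; rewrite cG; clear; lia.
  + rewrite setUA; apply: (sep_resolves Gc sep _ SB _ S0 _ res byp).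
    * by rewrite subUset sub1set vA.
    * by apply/set0Pn; exists v; rewrite setU11.
    * exact: resolvesS (subsetUr _ _) res1.
(* For a pendant edge the root [v] alone serves the side [A] and is not counted, so [S2] needs no
   addition. *)
- rewrite vEB in S2B; exists S2; split=> //.
  + exact: subset_trans S2B (sep_sub sep').
  + by move: cS2 (pendant_cyclomatic Gc sep vw defA); rewrite cG; clear; lia.
  + rewrite setUC; apply: (sep_resolves Gc sep' S2B _ S20 _ res2).
    * by rewrite sub1set.
    * by apply/set0Pn; exists v; rewrite inE.
    * rewrite setUC -defA -{2}vEA.
      by have /generatorP[] := generator_verts b (induced G A).
    * exact: pendant_bypasses sep vw defA.
Qed.

(** A 2-connected [G] is its own block. Otherwise both sides of a cut are rooted at the cut vertex
    [w], and [sep_resolves] yields a set resolving [G] with no root left over. *)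
Lemma dimension_bound b G : connected G -> 2 <= min_degree G -> ~ is_cycle G ->
  blocks_bounded b G -> ((dimension b G)%:Z <= 2 * cyclomatic G - 1)%R.
Proof.
move=> Gc mindeg ncyc bound.
have deg x : x \in verts G -> 2 <= degree G x.
  by move=> xG; apply: leq_trans mindeg _; rewrite /min_degree -leEnat; apply: bigmin_le_cond.
have G3 : 2 < #|verts G|.
  by have /set0Pn[x xG] := proj1 Gc; apply: leq_ltn_trans (deg x xG) (degree_lt_card xG).
have [tc|[w [A [B [sep Aw Bw]]]]] := separation_exists Gc (ltnW G3).
  exact: bound (two_connected_block tc G3) ncyc.
have side A' B' : separation G w A' B' -> A' != [set w] -> rooted_bound b (induced G A') w.
  move=> sp Aw'; apply: rooted_bound_exists (sep_connected sp Gc) _ _ _ _.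
  - by rewrite (verts_sep sp) (sep_in sp).
  - by rewrite (verts_sep sp) (sep_card_gt1 sp).
  - move=> x; rewrite (verts_sep sp) => xA xw.
    by rewrite (sep_degree sp) // deg // (subsetP (sep_sub sp)).
  - exact: sep_blocks_bounded sp bound.
have sep' := sepC sep.
have [S1 [S1A S10 cS1 res1]] := side A B sep Aw.
have [] := rooted_bound_bypass (sep_connected sep' Gc) _ (side B A sep' Bw).
  by rewrite (verts_sep sep') (sep_in sep').
move=> S2 [S2B S20 cS2 res2 byp]; rewrite (verts_sep sep) in S1A; rewrite (verts_sep sep') in S2B.
have le := dimension_le _ (sep_resolves Gc sep S1A S2B S10 S20 res1 res2 byp).
have {}le : dimension b G <= #|S1 :|: S2| by apply: le; rewrite -(sep_cover sep) setUSS.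
by move: le (leq_of_leqif (leq_card_setU S1 S2)) cS1 cS2; rewrite (sep_cyclomatic sep); clear; lia.
Qed.

End Blocks.

Theorem theorem10 (T : finType) (G : graph T)
    (Gconn : connected G)
    (Gdeg : 2 <= min_degree G)
    (Gncycle : ~ is_cycle G) :
  ((forall H : graph T, nontrivial_block G H -> ~ is_cycle H ->
      ((metric_dim H)%:Z <= 2 * cyclomatic H - 1)%R) ->
   ((metric_dim G)%:Z <= 2 * cyclomatic G - 1)%R)
  /\
  ((forall H : graph T, nontrivial_block G H -> ~ is_cycle H ->
      ((edge_metric_dim H)%:Z <= 2 * cyclomatic H - 1)%R) ->
   ((edge_metric_dim G)%:Z <= 2 * cyclomatic G - 1)%R).
Proof.
by split=> bound; [apply: (@dimension_bound T true) | apply: (@dimension_bound T false)].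
Qed.
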